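(* For every integer $n\geqslant 2$, the abstract commensurator group $\mathrm{Comm}(\mathrm{BS}(1,n))$ is isomorphic to the subgroup $$\left\{ \begin{pmatrix} 1 & q\\ 0 & p \end{pmatrix} \;\middle|\; q\in \mathbb{Q},\ p\in \mathbb{Q}^{\ast} \right\}$$ of $\mathrm{GL}_2(\mathbb{Q})$.
   Context: $\mathrm{BS}(1,n)$ is the Baumslag–Solitar group given by the presentation $\langle a,b\mid a^{-1}ba=b^n\rangle$. $\mathbb{Q}^{\ast}=\mathbb{Q}\setminus\{0\}$. Abstract commensurator group: for a group $G$, let $\Omega(G)$ be the set of all isomorphisms between subgroups of finite index of $G$. Two such isomorphisms $\varphi_1:H_1\to H_1'$ and $\varphi_2:H_2\to H_2'$ are equivalent, $\varphi_1\sim\varphi_2$, if there exists a subgroup $H$ of finite index in $G$ such that both $\varphi_1$ and $\varphi_2$ are defined on $H$ (i.e. $H\leqslant H_1\cap H_2$) and $\varphi_1|_H=\varphi_2|_H$. For $\alpha:G_1\to G_1'$ and $\beta:G_2\to G_2'$ in $\Omega(G)$, the product is $\alpha\beta:\alpha^{-1}(G_1'\cap G_2)\to\beta(G_1'\cap G_2)$, meaning first apply $\alpha$, then $\beta$. The quotient set $\Omega(G)/{\sim}$ with multiplication $[\alpha][\beta]=[\alpha\beta]$ is a group, denoted $\mathrm{Comm}(G)$. *)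

(* Defs.v *)
From HB Require Import structures.
From mathcomp Require Import all_boot all_order all_algebra.
From mathcomp Require Import boolp classical_sets functions cardinality.

Set Implicit Arguments.
Unset Strict Implicit.
Unset Printing Implicit Defensive.

Local Open Scope classical_set_scope.
Local Open Scope group_scope.
Local Open Scope quotient_scope.

(* Group presentations: the group is the set of words in the generators and
   their formal inverses, modulo the least congruence that contains the
   relations and the free cancellations. *)
Section Presentation.
Variables (X : choiceType).

(* (x, false) stands for x and (x, true) for x^-1 *)
Definition letter : Type := (X * bool)%type.
HB.instance Definition _ := Choice.on letter.

Definition inv_letter (l : letter) : letter := (l.1, ~~ l.2).

Definition inv_word (w : seq letter) : seq letter := rev (map inv_letter w).

Variable rels : seq letter -> seq letter -> Prop.

Inductive word_eq : seq letter -> seq letter -> Prop :=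
| word_eq_rel u v : rels u v -> word_eq u v
| word_eq_cancel l : word_eq [:: l; inv_letter l] [::]
| word_eq_cat u u' v v' :
    word_eq u u' -> word_eq v v' -> word_eq (u ++ v) (u' ++ v')
| word_eq_refl u : word_eq u u
| word_eq_sym u v : word_eq u v -> word_eq v u
| word_eq_trans u v w : word_eq u v -> word_eq v w -> word_eq u w.

Definition word_eqb : rel (seq letter) := fun u v => `[< word_eq u v >].

Lemma word_eqb_refl : reflexive word_eqb.
Proof. by move=> u; apply/asboolP; exact: word_eq_refl. Qed.

Lemma word_eqb_sym : symmetric word_eqb.
Proof. by move=> u v; apply/asboolP/asboolP; exact: word_eq_sym. Qed.

Lemma word_eqb_trans : transitive word_eqb.
Proof.
by move=> v u w /asboolP uv /asboolP vw; apply/asboolP; exact: word_eq_trans vw.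
Qed.

Canonical word_equiv :=
  EquivRel word_eqb word_eqb_refl word_eqb_sym word_eqb_trans.

Definition presented : Type := {eq_quot word_equiv}.
HB.instance Definition _ := Choice.on presented.

Definition pres_word (w : seq letter) : presented := \pi_{eq_quot word_equiv} w.

Definition pres_repr (g : presented) : seq letter :=
  repr (g : {eq_quot word_equiv}).

Lemma pres_wordP u v : pres_word u = pres_word v <-> word_eq u v.
Proof.
rewrite /pres_word; split=> [/eqmodP/asboolP //|uv].
by apply/eqmodP/asboolP.
Qed.

Lemma pres_reprK g : pres_word (pres_repr g) = g.
Proof. exact: reprK. Qed.

Lemma pres_repr_word w : word_eq (pres_repr (pres_word w)) w.
Proof. by apply/pres_wordP; rewrite pres_reprK. Qed.

Definition pres_one : presented := pres_word [::].
Definition pres_mul (g h : presented) : presented :=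
  pres_word (pres_repr g ++ pres_repr h).
Definition pres_inv (g : presented) : presented :=
  pres_word (inv_word (pres_repr g)).

Lemma pres_mul_word u v :
  pres_mul (pres_word u) (pres_word v) = pres_word (u ++ v).
Proof. by apply/pres_wordP; apply: word_eq_cat; exact: pres_repr_word. Qed.

Lemma inv_letterK : involutive inv_letter.
Proof. by case=> x b; rewrite /inv_letter /= negbK. Qed.

Lemma inv_wordK : involutive inv_word.
Proof.
move=> w; rewrite /inv_word map_rev revK -map_comp -[RHS]map_id.
by apply: eq_map => l /=; rewrite inv_letterK.
Qed.

Lemma word_eq_mulV w : word_eq (w ++ inv_word w) [::].
Proof.
elim: w => [|l w IHw]; first exact: word_eq_refl.
have -> : (l :: w) ++ inv_word (l :: w) =
    [:: l] ++ ((w ++ inv_word w) ++ [:: inv_letter l]).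
  by rewrite /inv_word /= rev_cons -cats1 -!catA.
apply: word_eq_trans (word_eq_cancel l).
rewrite -[in X in word_eq _ X]cat1s; apply: word_eq_cat.
  exact: word_eq_refl.
rewrite -[X in word_eq _ X]cat0s; apply: word_eq_cat => //.
exact: word_eq_refl.
Qed.

Lemma pres_mulA : associative pres_mul.
Proof.
move=> f g h.
rewrite -(pres_reprK f) -(pres_reprK g) -(pres_reprK h).
by rewrite !pres_mul_word catA.
Qed.

Lemma pres_mul1g : left_id pres_one pres_mul.
Proof. by move=> g; rewrite -(pres_reprK g) pres_mul_word. Qed.

Lemma pres_mulg1 : right_id pres_one pres_mul.
Proof. by move=> g; rewrite -(pres_reprK g) pres_mul_word cats0. Qed.

Lemma pres_mulgV : right_inverse pres_one pres_inv pres_mul.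
Proof.
move=> g; rewrite -[g in LHS]pres_reprK {2}pres_reprK /pres_inv pres_mul_word.
by apply/pres_wordP; exact: word_eq_mulV.
Qed.

Lemma pres_mulVg : left_inverse pres_one pres_inv pres_mul.
Proof.
move=> g; rewrite -[g in X in pres_mul _ X]pres_reprK /pres_inv pres_mul_word.
apply/pres_wordP; rewrite -[X in _ ++ X]inv_wordK; exact: word_eq_mulV.
Qed.

HB.instance Definition _ := isGroup.Build presented
  pres_mulA pres_mul1g pres_mulg1 pres_mulVg pres_mulgV.

End Presentation.

(* The generators a and b are encoded by false and true. *)
Section BaumslagSolitar.

Definition BS_a : letter bool := (false, false).
Definition BS_b : letter bool := (true, false).

Definition BS_rels (n : nat) (u v : seq (letter bool)) : Prop :=
  u = [:: inv_letter BS_a; BS_b; BS_a] /\ v = nseq n BS_b.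

Definition BS1 (n : nat) : groupType := presented (BS_rels n).

End BaumslagSolitar.

Section Commensurator.
Variable G : groupType.
Implicit Types (H K : set G).

Definition finite_index H : Prop :=
  finite_set (range (fun x : G => [set x * h | h in H])).

Definition fi_subgroup H : Prop := group_closed [in H] /\ finite_index H.

(* An isomorphism between finite index subgroups. The underlying function is
   total, but only its values on the domain matter: [comm_sim] below identifies
   any two records that agree on their common domain. *)
Record fi_iso := FiIso {
  fi_dom : set G;
  fi_cod : set G;
  fi_fun :> G -> G;
  fi_domP : fi_subgroup fi_dom;
  fi_codP : fi_subgroup fi_cod;
  fi_bij : set_bij fi_dom fi_cod fi_fun;
  fi_morph : {in fi_dom &, {morph fi_fun : x y / x * y}}
}.

HB.instance Definition _ := gen_eqMixin fi_iso.
HB.instance Definition _ := gen_choiceMixin fi_iso.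

Definition comm_sim (f g : fi_iso) : Prop :=
  exists H, [/\ fi_subgroup H, H `<=` fi_dom f `&` fi_dom g & {in H, f =1 g}].

Lemma subgroupP H : group_closed [in H] <->
  [/\ H 1, (forall x y, H x -> H y -> H (x * y)) & (forall x, H x -> H x^-1)].
Proof.
split=> [HG|[H1 HM HV]].
  have [H1 _] := HG; split.
  - by move: H1; rewrite inE.
  - move=> x y Hx Hy; have := group_closedM HG.
    by move=> /(_ x y); rewrite !inE; exact.
  - by move=> x Hx; have := group_closedV HG => /(_ x); rewrite !inE; exact.
split; first by rewrite inE.
by move=> x y; rewrite !inE => Hx Hy; apply: HM => //; exact: HV.
Qed.

Lemma finite_indexP H (T : Type) (A : set T) (c : G -> T) :
  group_closed [in H] -> finite_set A -> (forall x, A (c x)) ->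
  (forall x y, c x = c y -> H (x^-1 * y)) -> finite_index H.
Proof.
move=> /subgroupP[H1 HM HV] finA Ac cH.
pose g (t : T) := [set z | exists x, c x = t /\ H (x^-1 * z)].
apply: (@sub_finite_set _ _ (g @` A)); last exact: finite_image.
move=> _ [x _ <-]; exists (c x) => //; apply/seteqP; split=> z.
  move=> [y [cxy Hyz]]; exists (x^-1 * z); last by rewrite mulVKg.
  rewrite -[z](mulVKg y) mulgA; apply: HM => //.
  by apply: cH.
by move=> [h Hh <-]; exists x; rewrite mulKg.
Qed.

Lemma coset_eq H x y : group_closed [in H] ->
  [set x * h | h in H] = [set y * h | h in H] -> H (x^-1 * y).
Proof.
move=> /subgroupP[H1 _ _] xy.
have : [set x * h | h in H] y by rewrite xy; exists 1; rewrite ?mulg1.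
by move=> [h Hh <-]; rewrite mulKg.
Qed.

Lemma fi_subgroupT : fi_subgroup setT.
Proof.
have GT : group_closed [in [set: G]] by apply/subgroupP.
by split=> //; apply: (@finite_indexP _ unit setT (fun=> tt)).
Qed.

Lemma fi_fun_dom (f : fi_iso) x : fi_dom f x -> fi_cod f (f x).
Proof. by have [fd _ _] := fi_bij f; exact: fd. Qed.

Lemma fi_funM (f : fi_iso) x y :
  fi_dom f x -> fi_dom f y -> f (x * y) = f x * f y.
Proof. by move=> fx fy; apply: fi_morph; rewrite inE. Qed.

Lemma fi_inj (f : fi_iso) x y : fi_dom f x -> fi_dom f y -> f x = f y -> x = y.
Proof. by move=> fx fy; have [_ fi _] := fi_bij f; apply: fi; rewrite inE. Qed.

Lemma fi_surj (f : fi_iso) y : fi_cod f y -> exists2 x, fi_dom f x & f x = y.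
Proof. by have [_ _ fs] := fi_bij f; exact: fs. Qed.

Lemma fi_dom_group (f : fi_iso) :
  [/\ fi_dom f 1, (forall x y, fi_dom f x -> fi_dom f y -> fi_dom f (x * y))
    & (forall x, fi_dom f x -> fi_dom f x^-1)].
Proof. by apply/subgroupP; case: (fi_domP f). Qed.

Lemma fi_cod_group (f : fi_iso) :
  [/\ fi_cod f 1, (forall x y, fi_cod f x -> fi_cod f y -> fi_cod f (x * y))
    & (forall x, fi_cod f x -> fi_cod f x^-1)].
Proof. by apply/subgroupP; case: (fi_codP f). Qed.

Lemma fi_fun1 (f : fi_iso) : f 1 = 1.
Proof.
have [f1 _ _] := fi_dom_group f.
by apply: (mulgI (f 1)); rewrite -fi_funM // !mulg1.
Qed.

Lemma fi_funV (f : fi_iso) x : fi_dom f x -> f x^-1 = (f x)^-1.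
Proof.
move=> fx; have [_ _ /(_ _ fx) fV] := fi_dom_group f.
by apply: (mulgI (f x)); rewrite -fi_funM // !mulgV fi_fun1.
Qed.

Lemma fi_subgroup_preim (f : fi_iso) K :
  fi_subgroup K -> fi_subgroup (fi_dom f `&` f @^-1` K).
Proof.
move=> [KG Kfi]; have [f1 fM fV] := fi_dom_group f.
have /subgroupP[K1 KM KV] := KG.
have LG : group_closed [in fi_dom f `&` f @^-1` K].
  apply/subgroupP; split.
  - by split=> //=; rewrite fi_fun1.
  - move=> x y [fx Kx] [fy Ky]; split; first exact: fM.
    by rewrite /= fi_funM //; exact: KM.
  - move=> x [fx Kx]; split; first exact: fV.
    by rewrite /= fi_funV //; exact: KV.
split=> //; have [fG ffi] := fi_domP f.
pose cs x := [set x * h | h in fi_dom f].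
have csx x : cs x x by exists 1; rewrite ?mulg1.
pose r (C : set G) : G := xget 1 C.
have rP x : fi_dom f ((r (cs x))^-1 * x).
  apply: coset_eq => //; rewrite -/(cs _) -/(cs _).
  have [h fh rE] : cs x (r (cs x)).
    by rewrite /r; apply: (@xgetPex _ 1 (cs x)); exists x.
  rewrite -rE; apply/seteqP; split=> z.
    by move=> [k fk <-]; exists (h * k); [exact: fM | rewrite mulgA].
  move=> [k fk <-]; exists (h^-1 * k); last by rewrite -mulgA mulVKg.
  by apply: fM => //; exact: fV.
pose ck x := [set f ((r (cs x))^-1 * x) * h | h in K].
apply: (@finite_indexP _ _ (range cs `*` range (fun x => [set x * h | h in K]))
          (fun x => (cs x, ck x)) LG).
- exact: finite_setX.
- by move=> x; split=> /=; [exists x | exists (f ((r (cs x))^-1 * x))].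
move=> x y [csE ckE].
have xy : fi_dom f (x^-1 * y) by exact: coset_eq.
split=> //=; have := coset_eq KG ckE; rewrite -csE => HK.
suff -> : f (x^-1 * y) =
    (f ((r (cs x))^-1 * x))^-1 * f ((r (cs x))^-1 * y) by [].
have ry : fi_dom f ((r (cs x))^-1 * y) by rewrite csE.
rewrite -fi_funV // -fi_funM //; last exact: fV.
by rewrite invgM invgK -mulgA mulVKg.
Qed.

Lemma fi_id_bij : set_bij [set: G] setT id.
Proof. by split=> // x _; exists x. Qed.

Definition fi_id : fi_iso :=
  @FiIso setT setT id fi_subgroupT fi_subgroupT fi_id_bij (fun x y _ _ => erefl).

Lemma fi_subgroupI H K : fi_subgroup H -> fi_subgroup K -> fi_subgroup (H `&` K).
Proof.
move=> [HG Hfi] [KG Kfi].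
have /subgroupP[H1 HM HV] := HG; have /subgroupP[K1 KM KV] := KG.
have HKG : group_closed [in H `&` K].
  apply/subgroupP; split=> //.
  - by move=> x y [? ?] [? ?]; split; [exact: HM | exact: KM].
  - by move=> x [? ?]; split; [exact: HV | exact: KV].
split=> //.
apply: (@finite_indexP _ _ (range (fun x => [set x * h | h in H]) `*`
    range (fun x => [set x * h | h in K]))
    (fun x => ([set x * h | h in H], [set x * h | h in K])) HKG).
- exact: finite_setX.
- by move=> x; split=> /=; exists x.
- by move=> x y [/(coset_eq HG) ? /(coset_eq KG) ?].
Qed.

Definition fi_inv_fun (f : fi_iso) (y : G) : G :=
  xget 1 [set x | fi_dom f x /\ f x = y].

Lemma fi_inv_funP (f : fi_iso) y :
  fi_cod f y -> fi_dom f (fi_inv_fun f y) /\ f (fi_inv_fun f y) = y.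
Proof.
move=> /fi_surj[x fx fxy].
by apply: (@xgetPex _ 1 [set x | fi_dom f x /\ f x = y]); exists x.
Qed.

Lemma fi_funK (f : fi_iso) x : fi_dom f x -> fi_inv_fun f (f x) = x.
Proof. by move=> fx; have [? ?] := fi_inv_funP (fi_fun_dom fx); exact: (@fi_inj f). Qed.

Lemma fi_inv_bij f : set_bij (fi_cod f) (fi_dom f) (fi_inv_fun f).
Proof.
split.
- by move=> y /fi_inv_funP[].
- move=> y z; rewrite !inE => /fi_inv_funP[_ yE] /fi_inv_funP[_ zE] yz.
  by rewrite -yE -zE yz.
- by move=> x fx; exists (f x); [exact: fi_fun_dom | exact: fi_funK].
Qed.

Lemma fi_inv_morph f : {in fi_cod f &, {morph fi_inv_fun f : x y / x * y}}.
Proof.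
move=> y z; rewrite !inE => fy fz.
have [dy yE] := fi_inv_funP fy; have [dz zE] := fi_inv_funP fz.
have [_ dM _] := fi_dom_group f; have [_ cM _] := fi_cod_group f.
have [dyz yzE] := fi_inv_funP (cM _ _ fy fz).
by apply: (@fi_inj f) => //; [exact: dM | rewrite fi_funM // yE zE].
Qed.

Definition fi_inv (f : fi_iso) : fi_iso :=
  FiIso (fi_codP f) (fi_domP f) (@fi_inv_bij f) (@fi_inv_morph f).

Section Composition.
Variables f g : fi_iso.

Definition fi_comp_dom : set G := fi_dom f `&` f @^-1` (fi_cod f `&` fi_dom g).
Definition fi_comp_cod : set G := g @` (fi_cod f `&` fi_dom g).
Definition fi_comp_fun (x : G) : G := g (f x).

Lemma fi_comp_domP : fi_subgroup fi_comp_dom.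
Proof.
apply: fi_subgroup_preim.
by apply: fi_subgroupI; [exact: fi_codP | exact: fi_domP].
Qed.

Lemma fi_comp_codP : fi_subgroup fi_comp_cod.
Proof.
have -> : fi_comp_cod = fi_dom (fi_inv g) `&` fi_inv g @^-1` (fi_cod f).
  apply/seteqP; split=> z.
    move=> [y [fy gy] <-]; split; first exact: fi_fun_dom.
    by rewrite /preimage /= fi_funK.
  by move=> [/fi_inv_funP[dz zE] fz]; exists (fi_inv g z).
by apply: fi_subgroup_preim; exact: fi_codP.
Qed.

Lemma fi_comp_bij : set_bij fi_comp_dom fi_comp_cod fi_comp_fun.
Proof.
split.
- by move=> x [fx fgx]; exists (f x).
- move=> x y; rewrite !inE => -[fx [_ gx]] [fy [_ gy]] xy.
  by apply: (@fi_inj f) => //; exact: (@fi_inj g).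
- move=> _ [y [fy gy] <-]; have [x fx fxy] := fi_surj fy.
  by exists x; rewrite /fi_comp_dom /fi_comp_fun /= ?fxy.
Qed.

Lemma fi_comp_morph : {in fi_comp_dom &, {morph fi_comp_fun : x y / x * y}}.
Proof.
move=> x y; rewrite !inE => -[fx [_ gx]] [fy [_ gy]].
by rewrite /fi_comp_fun fi_funM // fi_funM.
Qed.

(* first f, then g *)
Definition fi_comp : fi_iso :=
  FiIso fi_comp_domP fi_comp_codP fi_comp_bij fi_comp_morph.

End Composition.

Definition comm_simb : rel fi_iso := fun f g => `[< comm_sim f g >].

Lemma comm_simb_refl : reflexive comm_simb.
Proof. by move=> f; apply/asboolP; exists (fi_dom f); split=> //; exact: fi_domP. Qed.

Lemma comm_sim_sym f g : comm_sim f g -> comm_sim g f.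
Proof.
move=> [H [HP Hfg fgE]]; exists H; split=> //; first by rewrite setIC.
by move=> x Hx; rewrite fgE.
Qed.

Lemma comm_simb_sym : symmetric comm_simb.
Proof. by move=> f g; apply/asboolP/asboolP; exact: comm_sim_sym. Qed.

Lemma comm_simb_trans : transitive comm_simb.
Proof.
move=> g f h /asboolP[H [HP Hfg fgE]] /asboolP[K [KP Kgh ghE]].
apply/asboolP; exists (H `&` K); split.
- exact: fi_subgroupI.
- by move=> x [/Hfg[? _] /Kgh[_ ?]].
- by move=> x; rewrite inE => -[Hx Kx]; rewrite fgE ?ghE // inE.
Qed.

Canonical comm_equiv :=
  EquivRel comm_simb comm_simb_refl comm_simb_sym comm_simb_trans.

Definition Comm : Type := {eq_quot comm_equiv}.
HB.instance Definition _ := Choice.on Comm.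

Definition comm_class (f : fi_iso) : Comm := \pi_{eq_quot comm_equiv} f.

Definition comm_repr (c : Comm) : fi_iso := repr (c : {eq_quot comm_equiv}).

Lemma comm_classP f g : comm_class f = comm_class g <-> comm_sim f g.
Proof.
rewrite /comm_class; split=> [/eqmodP/asboolP //|fg].
by apply/eqmodP/asboolP.
Qed.

Lemma comm_reprK c : comm_class (comm_repr c) = c.
Proof. exact: reprK. Qed.

Definition comm_one : Comm := comm_class fi_id.
Definition comm_mul (c d : Comm) : Comm :=
  comm_class (fi_comp (comm_repr c) (comm_repr d)).
Definition comm_inv (c : Comm) : Comm := comm_class (fi_inv (comm_repr c)).

Lemma comm_mul_class f g :
  comm_mul (comm_class f) (comm_class g) = comm_class (fi_comp f g).
Proof.
apply/comm_classP.
have /comm_classP[H [HP Hf fE]] := comm_reprK (comm_class f).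
have /comm_classP[K [KP Kg gE]] := comm_reprK (comm_class g).
set f' := comm_repr _ in Hf fE *; set g' := comm_repr _ in Kg gE *.
exists (H `&` (fi_dom f `&` f @^-1` K)); split.
- by apply: fi_subgroupI => //; exact: fi_subgroup_preim.
- move=> x [Hx [fx Kfx]]; have [f'x _] := Hf _ Hx; have [g'x gx] := Kg _ Kfx.
  have fxE : f' x = f x by apply: fE; rewrite inE.
  have f'c := fi_fun_dom f'x; have fc := fi_fun_dom fx.
  by split; split=> //; split=> //; rewrite fxE.
- move=> x; rewrite inE => -[Hx [fx Kfx]] /=.
  by rewrite /fi_comp_fun fE ?inE // gE // inE.
Qed.

Lemma comm_inv_class f : comm_mul (comm_inv (comm_class f)) (comm_class f) =
  comm_one /\ comm_mul (comm_class f) (comm_inv (comm_class f)) = comm_one.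
Proof.
rewrite /comm_inv -[in X in comm_mul _ X = _](comm_reprK (comm_class f)).
rewrite -[in X in comm_mul X (comm_class (fi_inv _)) = _](comm_reprK (comm_class f)).
rewrite !comm_mul_class; set g := comm_repr _; split; apply/comm_classP.
  exists (fi_cod g); split; first exact: fi_codP.
    by move=> y gy; have [? _] := fi_inv_funP gy; split.
  by move=> y; rewrite inE => /fi_inv_funP[].
exists (fi_dom g); split; first exact: fi_domP.
  by move=> x gx; have ? := fi_fun_dom gx; split.
by move=> x; rewrite inE => /fi_funK.
Qed.

Lemma comm_mulA : associative comm_mul.
Proof.
move=> c d e; rewrite -(comm_reprK c) -(comm_reprK d) -(comm_reprK e).
rewrite !comm_mul_class; set f := comm_repr c; set g := comm_repr d.
set h := comm_repr e; apply/comm_classP.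
have domE x : fi_dom (fi_comp (fi_comp f g) h) x ->
    [/\ fi_dom f x, fi_cod f (f x), fi_dom g (f x) & fi_dom h (g (f x))].
  by move=> [[fx [fc gx]] [_ hx]].
exists (fi_dom (fi_comp (fi_comp f g) h)); split=> //; first exact: fi_domP.
move=> x xP; have [fx fc gx hx] := domE _ xP.
have gc : fi_cod g (g (f x)) by exact: fi_fun_dom.
by split=> //; split=> //; split=> //; split.
Qed.

Lemma comm_mul1g : left_id comm_one comm_mul.
Proof.
move=> c; rewrite -(comm_reprK c) comm_mul_class; apply/comm_classP.
by exists (fi_dom (comm_repr c)); split=> //; exact: fi_domP.
Qed.

Lemma comm_mulg1 : right_id comm_one comm_mul.
Proof.
move=> c; rewrite -(comm_reprK c) comm_mul_class; apply/comm_classP.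
exists (fi_dom (comm_repr c)); split=> //; first exact: fi_domP.
by move=> x cx; split=> //; split=> //; split=> //; exact: fi_fun_dom.
Qed.

Lemma comm_mulVg : left_inverse comm_one comm_inv comm_mul.
Proof. by move=> c; rewrite -(comm_reprK c); case: (comm_inv_class (comm_repr c)). Qed.

Lemma comm_mulgV : right_inverse comm_one comm_inv comm_mul.
Proof. by move=> c; rewrite -(comm_reprK c); case: (comm_inv_class (comm_repr c)). Qed.

HB.instance Definition _ := isGroup.Build Comm
  comm_mulA comm_mul1g comm_mulg1 comm_mulVg comm_mulgV.

End Commensurator.

(* {'GL_n[R]} requires a finite ring R, hence this version. *)
Section GeneralLinear.
Variables (n : nat) (R : comUnitRingType).
Implicit Types A B : 'M[R]_n.

Definition GL : Type := {A : 'M[R]_n | A \in unitmx}.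
HB.instance Definition _ := SubChoice.on GL.

Lemma GL_one_subproof : (1%:M : 'M[R]_n)%R \in unitmx.
Proof. exact: unitmx1. Qed.

Lemma GL_mul_subproof (A B : GL) : (val A *m val B)%R \in unitmx.
Proof. by rewrite unitmx_mul; apply/andP; split; exact: valP. Qed.

Lemma GL_inv_subproof (A : GL) : invmx (val A) \in unitmx.
Proof. by rewrite unitmx_inv; exact: valP. Qed.

Definition GL_one : GL := Sub (1%:M)%R GL_one_subproof.
Definition GL_mul (A B : GL) : GL := Sub (val A *m val B)%R (GL_mul_subproof A B).
Definition GL_inv (A : GL) : GL := Sub (invmx (val A)) (GL_inv_subproof A).

Lemma GL_mulA : associative GL_mul.
Proof. by move=> A B C; apply: val_inj; exact: mulmxA. Qed.

Lemma GL_mul1g : left_id GL_one GL_mul.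
Proof. by move=> A; apply: val_inj; exact: mul1mx. Qed.

Lemma GL_mulg1 : right_id GL_one GL_mul.
Proof. by move=> A; apply: val_inj; exact: mulmx1. Qed.

Lemma GL_mulVg : left_inverse GL_one GL_inv GL_mul.
Proof. by move=> A; apply: val_inj; apply: mulVmx; exact: valP. Qed.

Lemma GL_mulgV : right_inverse GL_one GL_inv GL_mul.
Proof. by move=> A; apply: val_inj; apply: mulmxV; exact: valP. Qed.

HB.instance Definition _ := isGroup.Build GL
  GL_mulA GL_mul1g GL_mulg1 GL_mulVg GL_mulgV.

End GeneralLinear.

(* the matrix [1 q; 0 p] *)
Definition affine_mx (q p : rat) : 'M[rat]_(1 + 1) :=
  (block_mx (1%:M : 'M_1) (q%:M : 'M_1) (0 : 'M_1) (p%:M : 'M_1))%R.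

Definition affineQ : set (GL 2 rat) :=
  [set A | exists q p : rat, p != 0%R /\ val A = affine_mx q p].

Lemma affine_mxM (q p r s : rat) :
  (affine_mx q p *m affine_mx r s = affine_mx (r + q * s) (p * s))%R.
Proof.
rewrite /affine_mx mulmx_block !mul1mx !mulmx0 !mul0mx !GRing.addr0 !GRing.add0r.
by rewrite -!scalar_mxM GRing.raddfD.
Qed.

Lemma affine_mx1 : (1%:M = affine_mx 0 1)%R.
Proof. by rewrite /affine_mx GRing.raddf0 -scalar_mx_block. Qed.

Lemma affineQ_group_closed : group_closed [in affineQ].
Proof.
apply/subgroupP; split.
- by exists 0%R, 1%R; split=> //=; exact: affine_mx1.
- move=> A B [q [p [p0 AE]]] [r [s [s0 BE]]].
  exists (r + q * s)%R, (p * s)%R; split; first exact: GRing.mulf_neq0.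
  by rewrite -affine_mxM -AE -BE.
- move=> A [q [p [p0 AE]]]; exists (- q / p)%R, (p^-1)%R.
  split; first by rewrite GRing.invr_eq0.
  apply: (can_inj (mulKmx (valP A))).
  rewrite (mulmxV (valP A)) AE affine_mxM GRing.mulfV // -GRing.mulrDl.
  by rewrite GRing.addNr GRing.mul0r affine_mx1.
Qed.

(* Main.v *)
From HB Require Import structures.
Require Import Defs.
From mathcomp Require Import boolp cardinality ring.
From mathcomp Require Import all_boot all_algebra classical_sets functions.

Import GRing.Theory Num.Theory.

(** The group BS(1,n) embeds in the group of affine matrices [1 q; 0 p] over the
rationals, with b going to [1 1; 0 1] and a to [1 0; 0 n]. The image consists of
the matrices [1 x; 0 n^k] with x in Z[1/n] and k an integer: this is the model
of [BS1 n] given by [shift] (the entry x) and [height] (the exponent k), where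
[affine_inj] says that it is faithful and [exists_affine] that its image is as
described. In these terms the commensurators are exactly the conjugations by
rational affine matrices.

Each conjugation by [1 q; 0 p] restricts to an isomorphism between subgroups of
finite index ([exists_fi_iso]): if f is chosen so that multiplying by n^f - 1
brings q and p into Z[1/n], then the conjugation sends into the model every
element whose height is divisible by f and whose shift is divisible by n^f - 1
in Z[1/n], and these elements form a subgroup of finite index.

Conversely an isomorphism f between subgroups of finite index is such a
conjugation ([fi_iso_represented]). Its domain contains a translation u = b^m
and a dilation t = a^k. The relation v^t = v^(n^k) between a translation v and t
forces f to preserve translations, so that f scales all of them by one rational
number p. Conjugating u by an arbitrary h then recovers the height of f h, and
the commutator of t with h, which is again a translation, recovers its shift:
f is the conjugation by [1 q; 0 p], where q is determined by f t. Two
isomorphisms are equivalent precisely when they come from the same pair (q, p),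
since every subgroup of finite index contains such a u and such a t
([represents_unique], [represents_sim]). Composition of isomorphisms, in the
order first f then g, corresponds to the matrix product ([represents_comp]). *)

Set Implicit Arguments.
Unset Strict Implicit.
Unset Printing Implicit Defensive.

Local Open Scope classical_set_scope.
Local Open Scope ring_scope.

(** * Finite index subgroups *)

Lemma finite_set_repeat (T : Type) (A : set T) (c : nat -> T) :
  finite_set A -> (forall i, A (c i)) -> exists i j, (i < j)%N /\ c i = c j.
Proof.
move=> finA Ac; apply: contrapT => no_rep; apply: infinite_nat.
have c_inj : {in c @^-1` A &, injective c}.
  move=> i j _ _ cij; case: (ltngtP i j) => // lt_ij; case: no_rep.
    by exists i, j.
  by exists j, i.
apply: (sub_finite_set _ (finite_preimage c_inj finA)).
by move=> i _; exact: Ac.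
Qed.

(** Two of the cosets of the powers of x coincide. *)
Lemma finite_index_expg (G : groupType) (H : set G) (x : G) :
  fi_subgroup H -> exists2 m, (0 < m)%N & H (x ^+ m)%g.
Proof.
move=> [HG Hfi].
have [|i [j [lt_ij cij]]] := finite_set_repeat
  (c := fun i => [set (x ^+ i * h)%g | h in H]%classic) Hfi.
  by move=> i; exists (x ^+ i)%g.
exists (j - i)%N; first by rewrite subn_gt0.
have := coset_eq HG cij.
by rewrite -{1}(subnKC (ltnW lt_ij)) expgnDr mulKg.
Qed.

Lemma fi_subgroup_sub (G : groupType) (H K : set G) :
  fi_subgroup H -> H `<=` K -> group_closed [in K] -> fi_subgroup K.
Proof.
move=> [HG Hfi] HK KG; split=> //.
apply: (finite_indexP (c := fun x => [set (x * h)%g | h in H]) KG Hfi).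
  by move=> x; exists x.
by move=> x y /(coset_eq HG)/HK.
Qed.

Lemma fi_funX (G : groupType) (f : fi_iso G) x m : fi_dom f x ->
  fi_dom f (x ^+ m)%g /\ f (x ^+ m)%g = (f x ^+ m)%g.
Proof.
move=> fx; have [f1 fM _] := fi_dom_group f.
elim: m => [|m [fxm IHm]]; first by rewrite !expg0 fi_fun1.
by rewrite !expgS fi_funM // IHm; split=> //; exact: fM.
Qed.

Lemma fi_funJ (G : groupType) (f : fi_iso G) x y : fi_dom f x -> fi_dom f y ->
  fi_dom f (x ^ y)%g /\ f (x ^ y)%g = (f x ^ f y)%g.
Proof.
move=> fx fy; have [_ fM fV] := fi_dom_group f.
have fxy := fM _ _ fx fy; have fyV := fV _ fy.
by rewrite !conjgE !fi_funM // fi_funV //; split=> //; exact: fM.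
Qed.

(** * The ring Z[1/n] *)

Section Localization.
Variable n : nat.
Hypothesis n_gt1 : (2 <= n)%N.

(** Membership in the subring Z[1/n] of the rationals. *)
Definition localized (x : rat) : Prop :=
  exists j : nat, x * n%:R ^+ j \is a Num.int.

Lemma base_neq0 : n%:R != 0 :> rat.
Proof. by rewrite pnatr_eq0; case: n n_gt1. Qed.

Lemma int_localized x : x \is a Num.int -> localized x.
Proof. by move=> xZ; exists 0%N; rewrite mulr1. Qed.

Lemma localizedD x y : localized x -> localized y -> localized (x + y).
Proof.
move=> [i xi] [j yj]; exists (i + j)%N.
rewrite mulrDl exprD mulrA [X in _ + X]mulrCA.
by apply: rpredD; apply: rpredM => //; apply: rpredX; exact: natr_int.
Qed.

Lemma localizedM x y : localized x -> localized y -> localized (x * y).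
Proof.
by move=> [i xi] [j yj]; exists (i + j)%N; rewrite exprD mulrACA rpredM.
Qed.

Lemma localizedN x : localized x -> localized (- x).
Proof. by move=> [i xi]; exists i; rewrite mulNr rpredN. Qed.

Lemma localizedB x y : localized x -> localized y -> localized (x - y).
Proof. by move=> xl yl; apply: localizedD => //; exact: localizedN. Qed.

Lemma localized_exprz (k : int) : localized (n%:R ^ k).
Proof.
case: k => i; first by apply: int_localized; rewrite rpredX ?natr_int.
by exists i.+1; rewrite NegzE -exprnN mulVf ?expf_neq0 ?base_neq0.
Qed.

Lemma localized_exprzM (k : int) x : localized (x * n%:R ^ k) -> localized x.
Proof.
move=> xk; have -> : x = x * n%:R ^ k * n%:R ^ (- k).
  by rewrite -mulrA -expfzDr ?base_neq0 // subrr mulr1.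
by apply: localizedM => //; exact: localized_exprz.
Qed.

Lemma exprB1_neq0 f : (0 < f)%N -> (n%:R ^+ f - 1 : rat) != 0.
Proof.
move=> f_gt0; rewrite subr_eq0 -natrX -[1]/(1%:R) eqr_nat.
by rewrite neq_ltn orbC -(exp1n f) ltn_exp2r ?n_gt1.
Qed.

(** The powers of n^f are congruent to 1 modulo n^f - 1 in Z[1/n], the negative
ones included because n is a unit there. *)
Lemma localized_one_sub_exprz f (k : int) : (0 < f)%N -> (f %| k)%Z ->
  localized ((1 - n%:R ^ k) / (n%:R ^+ f - 1)).
Proof.
move=> f_gt0 /dvdzP[l ->].
have natl (i : nat) :
    localized ((1 - n%:R ^ (i * f)%N) / (n%:R ^+ f - 1)).
  rewrite -exprnP mulnC exprM -opprB subrX1 mulNr mulrAC.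
  rewrite divff ?exprB1_neq0 // mul1r.
  apply/localizedN/int_localized/rpred_sum => i' _.
  by rewrite !rpredX ?natr_int.
case: l => i; first exact: natl.
apply: (@localized_exprzM (i.+1 * f)%N); rewrite NegzE mulNr.
rewrite -PoszM mulrAC mulrBl mul1r -expfzDr ?base_neq0 // addNr expr0z.
by rewrite -opprB mulNr; apply: localizedN; exact: natl.
Qed.

(** The powers of n modulo d are eventually periodic. *)
Lemma dvdn_exp_cycle d : (0 < d)%N ->
  exists e f, (0 < f)%N /\ (d %| n ^ e * (n ^ f - 1))%N.
Proof.
move=> d_gt0.
have [|i [j [lt_ij /eqP ij]]] :=
    finite_set_repeat (c := fun i => (n ^ i %% d)%N) (finite_II d).
  by move=> i /=; rewrite ltn_mod.
exists i, (j - i)%N; rewrite subn_gt0 lt_ij; split=> //.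
rewrite mulnBr -expnD subnKC ?(ltnW lt_ij) // muln1.
by rewrite eq_sym eqn_mod_dvd // in ij; rewrite leq_exp2l // ltnW.
Qed.

(** Every positive integer divides some n^e (n^f - 1) with f > 0, and n^e is a unit
of Z[1/n]; hence denominators can be cleared up to elements of Z[1/n] by a factor n^f - 1, which
is prime to n. *)
Lemma clear_denominators (q p : rat) : exists2 f, (0 < f)%N &
  localized (q * (n%:R ^+ f - 1)) /\ localized (p * (n%:R ^+ f - 1)).
Proof.
have dq : (0 < `|(denq q * denq p)%R|)%N by rewrite absz_gt0 mulf_neq0 ?denq_neq0.
have [e [f [f_gt0 /dvdnP[c cE]]]] := dvdn_exp_cycle dq.
exists f => //.
have fE : (n%:R ^+ f - 1) * n%:R ^+ e = c%:R * (denq q)%:~R * (denq p)%:~R :> rat.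
  have := congr1 (fun m : nat => m%:R : rat) cE.
  rewrite abszM !natrM !natr_absz !gtr0_norm ?denq_gt0 //.
  by rewrite natrB ?expn_gt0 ?(ltnW n_gt1) // !natrX mulrC mulrA.
have num (x : rat) : x * (denq x)%:~R = (numq x)%:~R.
  by rewrite -{1}(divq_num_den x) divfK // intr_eq0 denq_neq0.
split; exists e; rewrite -mulrA fE.
  have -> a b : q * (c%:R * a * b) = q * a * c%:R * b by ring.
  by rewrite num !rpredM ?natr_int ?intr_int.
have -> a b : p * (c%:R * a * b) = p * b * c%:R * a by ring.
by rewrite num !rpredM ?natr_int ?intr_int.
Qed.

(** The quotient of Z[1/n] by n^f - 1 is finite. *)
Lemma localized_mod f x : (0 < f)%N -> localized x ->
  exists r : nat, (r < n ^ f - 1)%N /\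
    localized ((x - r%:R) / (n%:R ^+ f - 1)).
Proof.
move=> f_gt0 [j /intrP[m mE]].
set N := (n ^ f - 1)%N.
have NE : N%:R = n%:R ^+ f - 1 :> rat.
  by rewrite natrB ?expn_gt0 ?(ltnW n_gt1) // natrX.
have N_neq0 := exprB1_neq0 f_gt0.
have N_gt0 : (0 < N)%N by rewrite -(ltr_nat rat) lt0r ler0n NE N_neq0.
(* [x] is congruent to the integer [x * n ^ (f * j)] *)
pose m' : int := m * (n ^ (f.-1 * j))%N%:Z.
have m'E : m'%:~R = x * n%:R ^ (f * j)%N :> rat.
  rewrite /m' intrM -mE -pmulrn natrX -exprnP -mulrA -exprD; congr (_ * _ ^+ _).
  by rewrite -mulSn prednK.
pose r := (m' %% N)%Z.
have r_ge0 : 0 <= r by rewrite modz_ge0 // -lt0n.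
exists `|r|%N; split.
  by rewrite -ltz_nat gez0_abs // ltz_pmod.
have -> : `|r|%N%:R = r%:~R :> rat by rewrite natr_absz ger0_norm.
have -> : (x - r%:~R) / (n%:R ^+ f - 1) =
    x * ((1 - n%:R ^ (f * j)%N) / (n%:R ^+ f - 1)) + (m' %/ N)%Z%:~R.
  have -> : (r%:~R : rat) = m'%:~R - (m' %/ N)%Z%:~R * (n%:R ^+ f - 1).
    have -> : r = m' - (m' %/ N)%Z * N.
      by apply/eqP; rewrite eq_sym subr_eq addrC -divz_eq.
    by rewrite intrB intrM -NE.
  by rewrite m'E; field.
apply: localizedD; last by apply: int_localized; exact: intr_int.
apply: localizedM; first by exists j; rewrite mE intr_int.
by apply: localized_one_sub_exprz => //; rewrite PoszM dvdz_mulr.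
Qed.

End Localization.

(** * The affine model of BS(1,n) *)

Section AffineModel.
Variable n : nat.
Hypothesis n_gt1 : (2 <= n)%N.
Local Notation G := (BS1 n).

Definition letter_height (l : letter bool) : int :=
  if l.1 then 0 else if l.2 then -1 else 1.

Definition letter_shift (l : letter bool) : rat :=
  if l.1 then (if l.2 then -1 else 1) else 0.

Definition word_height (w : seq (letter bool)) : int :=
  \sum_(l <- w) letter_height l.

(** The recursion follows the product
[1 x; 0 p] [1 y; 0 s] = [1 (y + x s); 0 (p s)]. *)
Fixpoint word_shift (w : seq (letter bool)) : rat :=
  if w is l :: w' then
    word_shift w' + letter_shift l * n%:R ^ word_height w'
  else 0.

(** The element g corresponds to the matrix [1 (shift g); 0 (n ^ height g)]. *)
Definition height (g : G) : int := word_height (pres_repr g).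
Definition shift (g : G) : rat := word_shift (pres_repr g).
Definition scale (g : G) : rat := n%:R ^ height g.

Lemma word_height_nil : word_height [::] = 0.
Proof. exact: big_nil. Qed.

Lemma word_height_cons l w : word_height (l :: w) = letter_height l + word_height w.
Proof. exact: big_cons. Qed.

Lemma word_height_cat u v : word_height (u ++ v) = word_height u + word_height v.
Proof. exact: big_cat. Qed.

Lemma word_shift_cat u v :
  word_shift (u ++ v) = word_shift v + word_shift u * n%:R ^ word_height v.
Proof.
elim: u => [|l u IHu] /=; first by rewrite mul0r addr0.
rewrite IHu word_height_cat expfzDr ?base_neq0 //; ring.
Qed.

Lemma word_eq_affine u v : word_eq (BS_rels n) u v ->
  word_height u = word_height v /\ word_shift u = word_shift v.
Proof.
elim=> {u v} [u v [-> ->]|[[] []]|u u' v v' _ [hu su] _ [hv sv]|//|u v _ [-> ->]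
    |u v w _ [-> ->] _ [-> ->]] //.
- have nseqE m : word_height (nseq m BS_b) = 0 /\ word_shift (nseq m BS_b) = m%:R.
    elim: m => [|m [hm sm]]; first by rewrite word_height_nil.
    by rewrite /= word_height_cons hm sm expr0z mulr1 -natr1.
  have [-> ->] := nseqE n.
  rewrite /= !word_height_cons !word_height_nil /letter_height /letter_shift /=.
  by rewrite !addr0 add0r; split; [ring | rewrite !mul0r add0r mul1r addr0].
- by rewrite /= !word_height_cons !word_height_nil /letter_height
             /letter_shift /= !addr0 expr0z; split; ring.
- by rewrite /= !word_height_cons !word_height_nil /letter_height
             /letter_shift /= !addr0 expr0z; split; ring.
- by rewrite /= !word_height_cons !word_height_nil /letter_height
             /letter_shift /= !mul0r; split; ring.
- by rewrite /= !word_height_cons !word_height_nil /letter_height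
             /letter_shift /= !mul0r; split; ring.
- by rewrite !word_height_cat !word_shift_cat hu su hv sv.
Qed.

Definition BS_word (w : seq (letter bool)) : G := pres_word (BS_rels n) w.

Lemma BS_word_cat u v : BS_word (u ++ v) = (BS_word u * BS_word v)%g.
Proof. by symmetry; exact: pres_mul_word. Qed.

Lemma BS_wordV w : BS_word (inv_word w) = (BS_word w)^-1%g.
Proof.
symmetry; apply: mulg1_eq; rewrite -BS_word_cat.
by apply/pres_wordP; exact: word_eq_mulV.
Qed.

Lemma BS_word_nseq l m : BS_word (nseq m l) = (BS_word [:: l] ^+ m)%g.
Proof.
elim: m => [|m IHm]; first by rewrite expg0.
by rewrite expgS -IHm -BS_word_cat.
Qed.

Lemma BS_word_affine w :
  height (BS_word w) = word_height w /\ shift (BS_word w) = word_shift w.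
Proof. exact: word_eq_affine (pres_repr_word _ w). Qed.

Lemma heightM (g h : G) : height (g * h)%g = height g + height h.
Proof.
have [-> _] := BS_word_affine (pres_repr g ++ pres_repr h).
exact: word_height_cat.
Qed.

Lemma shiftM (g h : G) : shift (g * h)%g = shift h + shift g * scale h.
Proof.
have [_ ->] := BS_word_affine (pres_repr g ++ pres_repr h).
exact: word_shift_cat.
Qed.

Lemma scaleM (g h : G) : scale (g * h)%g = scale g * scale h.
Proof. by rewrite /scale heightM expfzDr ?base_neq0. Qed.

Lemma scale_neq0 (g : G) : scale g != 0.
Proof. by rewrite expfz_neq0 ?base_neq0. Qed.

Lemma height1 : height 1%g = 0.
Proof. by have [-> _] := BS_word_affine [::]; rewrite word_height_nil. Qed.

Lemma shift1 : shift 1%g = 0.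
Proof. by have [_ ->] := BS_word_affine [::]. Qed.

Lemma heightV (g : G) : height g^-1%g = - height g.
Proof. by apply/eqP; rewrite -addr_eq0 -heightM mulVg height1. Qed.

Lemma scaleV (g : G) : scale g^-1%g = (scale g)^-1.
Proof. by rewrite /scale heightV invr_expz. Qed.

Lemma shiftV (g : G) : shift g^-1%g = - shift g / scale g.
Proof.
have := shiftM g g^-1%g; rewrite mulgV shift1 scaleV => /eqP.
by rewrite eq_sym addr_eq0 mulNr => /eqP.
Qed.

Lemma heightX (g : G) m : height (g ^+ m)%g = height g *+ m.
Proof. by elim: m => [|m IHm]; rewrite ?expg0 ?height1 // expgS heightM IHm mulrS. Qed.

Lemma shiftX_height0 (g : G) m : height g = 0 -> shift (g ^+ m)%g = shift g *+ m.
Proof.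
move=> g0; elim: m => [|m IHm]; first by rewrite expg0 shift1.
by rewrite expgSr shiftM IHm /scale g0 expr0z mulr1 mulrS.
Qed.

Lemma shiftX_shift0 (g : G) m : shift g = 0 -> shift (g ^+ m)%g = 0.
Proof.
move=> g0; elim: m => [|m IHm]; first by rewrite expg0 shift1.
by rewrite expgSr shiftM IHm g0 mul0r addr0.
Qed.

Definition gen_a : G := BS_word [:: BS_a].
Definition gen_b : G := BS_word [:: BS_b].

Lemma gen_a_affine : height gen_a = 1 /\ shift gen_a = 0.
Proof.
have [-> ->] := BS_word_affine [:: BS_a].
by rewrite /= !word_height_cons !word_height_nil mul0r.
Qed.

Lemma gen_b_affine : height gen_b = 0 /\ shift gen_b = 1.
Proof.
have [-> ->] := BS_word_affine [:: BS_b].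
by rewrite /= !word_height_cons !word_height_nil expr0z.
Qed.

Lemma BS_relation : (gen_b ^ gen_a = gen_b ^+ n)%g.
Proof.
rewrite /gen_a /gen_b -BS_word_nseq conjgE -BS_wordV -(BS_word_cat [:: BS_b]).
rewrite -BS_word_cat.
by apply/pres_wordP/word_eq_rel; split.
Qed.

(** The cyclic group generated by b; a quotient of two natural powers stands for
an integer power. *)
Definition power_of_b (z : G) : Prop := exists k l, z = (gen_b ^+ k / gen_b ^+ l)%g.

Lemma power_of_bM y z : power_of_b y -> power_of_b z -> power_of_b (y * z)%g.
Proof.
move=> [i [j ->]] [k [l ->]]; exists (i + k)%N, (j + l)%N.
rewrite [(j + l)%N]addnC !expgnDr invgM -!mulgA; congr (_ * _)%g.
rewrite !mulgA; congr (_ * _)%g.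
by apply/commute_sym/commuteV/commuteX2; exact: commute_refl.
Qed.

Lemma power_of_bJ z : power_of_b z -> power_of_b (z ^ gen_a)%g.
Proof.
move=> [k [l ->]]; exists (n * k)%N, (n * l)%N.
by rewrite conjMg conjVg !conjXg BS_relation !expgnA.
Qed.

Lemma power_of_bJX z j : power_of_b z -> power_of_b (z ^ (gen_a ^+ j))%g.
Proof.
elim: j z => [|j IHj] z bz; first by rewrite expg0 conjg1.
by rewrite expgS conjgM; apply: IHj; exact: power_of_bJ.
Qed.

(** Every element is some a^i b^m a^-j: since a^-1 b a is a power of b, the
elements that have this form are stable under right multiplication by the
letters. *)
Lemma normal_form (g : G) :
  exists i j, power_of_b (gen_a ^- i * g * gen_a ^+ j)%g.
Proof.
rewrite -(pres_reprK g) -/(BS_word _).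
elim/last_ind: (pres_repr g) => [|w l [i [j bw]]].
  by exists 0%N, 0%N, 0%N, 0%N; rewrite !expg0 mulgV mulg1 invg1 mul1g.
have bb : power_of_b gen_b.
  by exists 1%N, 0%N; rewrite expg1 expg0 invg1 mulg1.
have bV : power_of_b gen_b^-1%g.
  by exists 0%N, 1%N; rewrite expg1 expg0 mul1g.
rewrite -cats1 BS_word_cat.
have mulb (z : G) : power_of_b z ->
    exists i j, power_of_b (gen_a ^- i * (BS_word w * z) * gen_a ^+ j)%g.
  move=> bz; exists i, j.
  have -> : (gen_a ^- i * (BS_word w * z) * gen_a ^+ j =
      gen_a ^- i * BS_word w * gen_a ^+ j * (z ^ (gen_a ^+ j)))%g.
    by rewrite conjgE !mulgA mulgK.
  by apply: power_of_bM => //; exact: power_of_bJX.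
case: l => [[] []].
- by rewrite (BS_wordV [:: BS_b]); exact: mulb.
- exact: mulb.
- exists i, j.+1; rewrite (BS_wordV [:: BS_a]).
  by rewrite expgS -!mulgA mulKg mulgA.
- exists i.+1, j.
  have -> : (gen_a ^- i.+1 * (BS_word w * gen_a) * gen_a ^+ j =
      (gen_a ^- i * BS_word w * gen_a ^+ j) ^ gen_a)%g.
    by rewrite conjgE expgSr invgM -!mulgA -expgSr expgS.
  exact: power_of_bJ.
Qed.

(** By the normal form, an element of the kernel is a^i b^m a^-j where the height
i - j and the shift m n^-j vanish, so that it is trivial. *)
Lemma affine_inj (g h : G) : shift g = shift h -> height g = height h -> g = h.
Proof.
move=> sgh hgh; apply: divg1_eq.
have : shift (g / h)%g = 0.
  by rewrite shiftM shiftV scaleV sgh; field; exact: scale_neq0.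
have : height (g / h)%g = 0 by rewrite heightM heightV hgh subrr.
move: (g / h)%g => {g h sgh hgh} g hg sg.
have [i [j [k [l gE]]]] := normal_form g.
have [ha sa] := gen_a_affine; have [hb sb] := gen_b_affine.
have ij : i = j.
  have := congr1 height gE.
  rewrite !heightM !heightV !heightX ha hb hg !mul0rn subrr addr0 => /eqP.
  by rewrite addrC subr_eq0 eqr_nat => /eqP.
have kl : k = l.
  have := congr1 shift gE.
  rewrite !shiftM !shiftV !(shiftX_shift0 _ sa) !(shiftX_height0 _ hb) sg sb.
  rewrite /scale !heightV !heightX hb mul0rn oppr0 expr0z divr1 mulr1.
  rewrite !(mul0r, add0r) => /esym/eqP.
  by rewrite addrC subr_eq0 eqr_nat => /eqP.
move: gE; rewrite ij kl mulgV => /(congr1 (fun z => gen_a ^+ j * z / gen_a ^+ j)%g).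
by rewrite -!mulgA mulgV mulg1 mulVKg mul1g mulgV.
Qed.

Lemma exists_height k : exists g : G, shift g = 0 /\ height g = k.
Proof.
have [ha sa] := gen_a_affine; case: k => i.
  by exists (gen_a ^+ i)%g; rewrite shiftX_shift0 // heightX ha -natz.
exists (gen_a ^- i.+1)%g.
by rewrite shiftV heightV shiftX_shift0 // heightX ha oppr0 mul0r NegzE -natz.
Qed.

Lemma exists_int_shift (m : int) : exists g : G, shift g = m%:~R /\ height g = 0.
Proof.
have [hb sb] := gen_b_affine; case: m => i.
  by exists (gen_b ^+ i)%g; rewrite shiftX_height0 // heightX hb sb mul0rn.
exists (gen_b ^- i.+1)%g.
by rewrite shiftV heightV shiftX_height0 // /scale heightX hb sb mul0rn oppr0 expr0z
           divr1 NegzE mulrNz.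
Qed.

(** The matrix with entries x = m / n^j and n^k is the image of
a^(k + j) b^m a^-j. *)
Lemma exists_affine x k : localized n x ->
  exists g : G, shift g = x /\ height g = k.
Proof.
move=> [j /intrP[m mE]].
have [c [sc hc]] := exists_height (k + j%:Z).
have [d [sd hd]] := exists_height (- j%:Z).
have [b [sb hb]] := exists_int_shift m.
exists (c * b * d)%g; rewrite !shiftM !heightM sc hc sd hd sb hb.
split; last by rewrite addr0 addrK.
rewrite mul0r addr0 add0r -mE exprnP /scale hd -mulrA -expfzDr ?base_neq0 //.
by rewrite subrr mulr1.
Qed.

Lemma shift_localized (g : G) : localized n (shift g).
Proof.
rewrite /shift; elim: (pres_repr g) => [|l w IHw] /=.
  exact: int_localized.
apply: localizedD => //; apply: localizedM; last exact: localized_exprz.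
by apply: int_localized; case: l => [[] []] /=; rewrite ?rpredN ?rpred1 ?rpred0.
Qed.

End AffineModel.

(** * Finite index isomorphisms are affine conjugations *)

Section Rigidity.
Variable n : nat.
Hypothesis n_gt1 : (2 <= n)%N.
Local Notation G := (BS1 n).

Lemma heightJ (g h : G) : height (g ^ h)%g = height g.
Proof. by rewrite conjgE !(heightM n_gt1) (heightV n_gt1) addrCA addNr addr0. Qed.

Lemma shiftJ (g h : G) :
  shift (g ^ h)%g = shift g * scale h + shift h * (1 - scale g).
Proof.
have h0 := scale_neq0 n_gt1 h.
by rewrite conjgE !(shiftM n_gt1) (shiftV n_gt1) (scaleM n_gt1); field.
Qed.

Lemma shiftR (g h : G) : shift [~ g, h]%g =
  shift h * (1 - scale g) - shift g * (1 - scale h).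
Proof.
have g0 := scale_neq0 n_gt1 g.
rewrite commgEl (shiftM n_gt1) (shiftV n_gt1) shiftJ.
have -> : scale (g ^ h)%g = scale g by rewrite /scale heightJ.
by field.
Qed.

Lemma scale_inj (g h : G) : scale g = scale h -> height g = height h.
Proof.
apply: ieexprIz; first by rewrite ltr0n (ltnW n_gt1).
by rewrite -[1]/(1%:R) eqr_nat neq_ltn n_gt1 orbT.
Qed.

(** For p nonzero: in the affine model g' is A^-1 g A, where A = [1 q; 0 p]. *)
Definition affine_conj (q p : rat) (g g' : G) : Prop :=
  shift g' = p * shift g + q * (1 - scale g) /\ height g' = height g.

Definition represents (f : fi_iso G) (q p : rat) : Prop :=
  p != 0 /\ forall g, fi_dom f g -> affine_conj q p g (f g).

Lemma exists_dilation H : fi_subgroup H -> exists t : G,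
  [/\ H t, shift t = 0, scale t != 1 & exists2 k, (0 < k)%N & height t = k].
Proof.
move=> /(@finite_index_expg _ _ (gen_a n))[k k_gt0 Ht].
have [ha sa] := gen_a_affine n_gt1.
have kE : height (gen_a n ^+ k)%g = k by rewrite (heightX n_gt1) ha -natz.
exists (gen_a n ^+ k)%g; split=> //; first by rewrite (shiftX_shift0 n_gt1).
  by rewrite /scale kE -subr_eq0 -exprnP exprB1_neq0.
by exists k.
Qed.

Lemma exists_translation H : fi_subgroup H -> exists u : G,
  [/\ H u, height u = 0 & exists2 m, (0 < m)%N & shift u = m%:R].
Proof.
move=> /(@finite_index_expg _ _ (gen_b n))[m m_gt0 Hu].
have [hb sb] := gen_b_affine n_gt1.
exists (gen_b n ^+ m)%g; split=> //; first by rewrite (heightX n_gt1) hb mul0rn.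
by exists m => //; rewrite (shiftX_height0 n_gt1) // sb.
Qed.

(** Translations go to translations: if t = a^k lies in the domain then
v^t = v^(n^k), and comparing the heights of the images shows that the height
of f v equals n^k times itself. *)
Lemma height0_fi_fun (f : fi_iso G) v :
  fi_dom f v -> height v = 0 -> height (f v) = 0.
Proof.
move=> fv hv.
have [t [ft st _ [k k_gt0 ht]]] := exists_dilation (fi_domP f).
have vt : (v ^ t = v ^+ (n ^ k))%g.
  apply: (affine_inj n_gt1); last by rewrite heightJ (heightX n_gt1) hv mul0rn.
  rewrite shiftJ st mul0r addr0 (shiftX_height0 n_gt1) //.
  by rewrite /scale ht -exprnP -natrX mulr_natr.
have := congr1 (fun x => height (f x)) vt.
have [_ ->] := fi_funJ fv ft; have [_ ->] := fi_funX (n ^ k) fv.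
rewrite heightJ (heightX n_gt1) => /esym/eqP.
rewrite -subr_eq0 -[X in _ - X]mulr1n -mulrnBr ?expn_gt0 ?(ltnW n_gt1) //.
rewrite -mulr_natr mulf_eq0 => /orP[/eqP //|].
by rewrite pnatr_eq0 subn_eq0 leqNgt -(exp1n k) ltn_exp2r ?n_gt1.
Qed.

(** On translations f is a homomorphism between subgroups of the rationals, so it
is multiplication by a constant. *)
Lemma shift_fi_fun (f : fi_iso G) u v : fi_dom f u -> fi_dom f v ->
  height u = 0 -> height v = 0 -> shift u != 0 ->
  shift (f v) = shift v / shift u * shift (f u).
Proof.
move=> fu fv hu hv u0; set w := shift v / shift u.
have [_ fM _] := fi_dom_group f.
(* the numerator of w is written b - a, to use natural powers only *)
have [a [b wE]] : exists a b : nat, w * `|denq w|%N%:R + a%:R = b%:R.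
  have -> : w * `|denq w|%N%:R = (numq w)%:~R.
    rewrite natr_absz ger0_norm // -{1}(divq_num_den w) divfK //.
    by rewrite intr_eq0 denq_neq0.
  case: (numq w) => i; first by exists 0%N, i; rewrite addr0.
  by exists i.+1, 0%N; rewrite NegzE mulrNz addNr.
have d0 : `|denq w|%N%:R != 0 :> rat by rewrite pnatr_eq0 absz_eq0 denq_neq0.
have [fvd fvdE] := fi_funX `|denq w| fv.
have [fua fuaE] := fi_funX a fu; have [_ fubE] := fi_funX b fu.
have hfu := height0_fi_fun fu hu; have hfv := height0_fi_fun fv hv.
have shiftXX (x y : G) c d : height x = 0 -> height y = 0 ->
    shift (x ^+ c * y ^+ d)%g = shift x * c%:R + shift y * d%:R :> rat.
  move=> hx hy; rewrite (shiftM n_gt1) !(shiftX_height0 n_gt1) //.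
  rewrite /scale (heightX n_gt1) hy.
  by rewrite mul0rn expr0z mulr1 addrC !mulr_natr.
have vu : (v ^+ `|denq w| * u ^+ a = u ^+ b)%g.
  apply: (affine_inj n_gt1); last first.
    by rewrite (heightM n_gt1) !(heightX n_gt1) hu hv !mul0rn.
  rewrite shiftXX // (shiftX_height0 n_gt1) // -[RHS]mulr_natr -wE /w; field.
  by rewrite u0.
have := congr1 (fun x => shift (f x)) vu.
rewrite fi_funM // fvdE fuaE fubE shiftXX // (shiftX_height0 n_gt1) //.
rewrite -[shift (f u) *+ b]mulr_natr -wE => E.
apply: (mulIf d0); apply: (addIr (shift (f u) * a%:R)); rewrite E; ring.
Qed.

(** The multiplier p is read off from a translation u, and q from a dilation t of
the domain: [1 0; 0 T] is conjugated by [1 q; 0 p] to [1 q(1 - T); 0 T]. For any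
other h, the height of f h is determined by the translation u^h, and its shift by
the translation [~ t, h]. *)
Lemma fi_iso_represented (f : fi_iso G) : exists q p, represents f q p.
Proof.
have [t [ft st t_neq1 _]] := exists_dilation (fi_domP f).
have [u [fu hu [m m_gt0 su]]] := exists_translation (fi_domP f).
have u0 : shift u != 0 by rewrite su pnatr_eq0 -lt0n.
have hfu := height0_fi_fun fu hu.
have fu0 : shift (f u) != 0.
  apply/eqP => sfu; have : f u = f 1%g.
    apply: (affine_inj n_gt1); rewrite fi_fun1 ?(shift1 n_gt1) //.
    by rewrite hfu (height1 n_gt1).
  move=> /fi_inj; have [f1 _ _] := fi_dom_group f => /(_ fu f1) u1.
  by move: u0; rewrite u1 (shift1 n_gt1) eqxx.
have scale0 (g : G) : height g = 0 -> scale g = 1 by rewrite /scale => ->.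
have heightE h : fi_dom f h -> height (f h) = height h.
  move=> fh; have [fuh uhE] := fi_funJ fu fh; apply: scale_inj.
  have := shift_fi_fun fu fuh hu _ u0; rewrite heightJ => /(_ hu).
  rewrite uhE !shiftJ (scale0 _ hu) (scale0 _ hfu) subrr !mulr0 !addr0.
  rewrite [shift u * _]mulrC mulfK //.
  by rewrite mulrC => /(mulIf fu0).
pose p := shift (f u) / shift u; pose q := shift (f t) / (1 - scale t).
exists q, p; split; first by rewrite mulf_neq0 // invr_neq0.
move=> h fh; split; last exact: heightE.
have [_ fM fV] := fi_dom_group f.
have [fth thE] := fi_funJ ft fh.
have fc : fi_dom f [~ t, h]%g by rewrite commgEl; apply: fM => //; exact: fV.
have cE : f [~ t, h]%g = [~ f t, f h]%g.
  by rewrite !commgEl fi_funM ?fi_funV // ?thE //; exact: fV.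
have hc : height [~ t, h]%g = 0.
  by rewrite commgEl (heightM n_gt1) (heightV n_gt1) heightJ addNr.
have := shift_fi_fun fu fc hu hc u0; rewrite cE !shiftR st.
have -> : scale (f t) = scale t by rewrite /scale heightE.
have -> : scale (f h) = scale h by rewrite /scale heightE.
have t1 : 1 - scale t != 0 by rewrite subr_eq0 eq_sym.
rewrite mul0r subr0 => /eqP; rewrite subr_eq => /eqP E; apply: (mulIf t1).
by rewrite E /p /q; field; rewrite u0 t1.
Qed.

(** A translation of the common domain determines p, and a dilation of
zero shift determines q. *)
Lemma represents_unique (f g : fi_iso G) q p r s : comm_sim f g ->
  represents f q p -> represents g r s -> q = r /\ p = s.
Proof.
move=> [H [HP Hfg fgE]] [_ fE] [_ gE].
have [t [Ht st t_neq1 _]] := exists_dilation HP.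
have [u [Hu hu [m m_gt0 su]]] := exists_translation HP.
have E h : H h -> p * shift h + q * (1 - scale h) = s * shift h + r * (1 - scale h).
  move=> Hh; have [fh gh] := Hfg _ Hh.
  by have [<- _] := fE _ fh; have [<- _] := gE _ gh; rewrite fgE ?inE.
split.
  have := E _ Ht; rewrite st !mulr0 !add0r; apply: mulIf.
  by rewrite subr_eq0 eq_sym.
have := E _ Hu; rewrite /scale hu expr0z subrr !mulr0 !addr0 su; apply: mulIf.
by rewrite pnatr_eq0 -lt0n.
Qed.

Lemma represents_sim (f g : fi_iso G) q p :
  represents f q p -> represents g q p -> comm_sim f g.
Proof.
move=> [_ fE] [_ gE]; exists (fi_dom f `&` fi_dom g); split=> //.
  by apply: fi_subgroupI; exact: fi_domP.
move=> h; rewrite inE => -[/fE[fs fh] /gE[gs gh]].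
by apply: (affine_inj n_gt1); rewrite ?fs ?gs ?fh ?gh.
Qed.

Lemma affine_conj_comp q p r s (g g' g'' : G) : affine_conj q p g g' ->
  affine_conj r s g' g'' -> affine_conj (r + q * s) (p * s) g g''.
Proof.
move=> [sg' hg'] [sg'' hg'']; split; last by rewrite hg''.
rewrite sg'' sg'; have -> : scale g' = scale g by rewrite /scale hg'.
ring.
Qed.

Lemma represents_comp (f g : fi_iso G) q p r s : represents f q p ->
  represents g r s -> represents (fi_comp f g) (r + q * s) (p * s).
Proof.
move=> [p0 fE] [s0 gE]; split; first exact: mulf_neq0.
move=> h [/fE fh [_ /gE gh]]; exact: affine_conj_comp fh gh.
Qed.

(** * Affine conjugations are finite index isomorphisms *)

(** This subgroup is the kernel of the reduction of BS(1,n) to the semidirect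
product of Z/f and Z/(n^f - 1), where the generator of Z/f acts as
multiplication by n. *)
Lemma congruence_subgroup_fi f : (0 < f)%N -> fi_subgroup
  [set g : G | (f %| height g)%Z /\ localized n (shift g / (n%:R ^+ f - 1))].
Proof.
move=> f_gt0; set H := [set g | _]; pose N : rat := n%:R ^+ f - 1.
have N0 : N != 0 by exact: exprB1_neq0.
have HG : group_closed [in H].
  apply/subgroupP; split.
  - by rewrite /H /= (height1 n_gt1) (shift1 n_gt1) dvdz0 mul0r; split=> //;
       exact: int_localized.
  - move=> g h [fg Ng] [fh Nh]; split.
      by rewrite (heightM n_gt1) rpredD.
    rewrite (shiftM n_gt1) mulrDl mulrAC; apply: localizedD => //.
    by apply: localizedM => //; exact: localized_exprz.
  - move=> g [fg Ng]; split; first by rewrite (heightV n_gt1) rpredN.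
    rewrite (shiftV n_gt1) mulrAC mulNr; apply: localizedM.
      exact: localizedN.
    by rewrite -(scaleV n_gt1); exact: localized_exprz.
have /choice[r rP] (g : G) : exists r : nat, (r < n ^ f - 1)%N /\
    localized n ((shift g - r%:R) / N).
  by apply: localized_mod => //; exact: shift_localized.
split=> //; apply: (finite_indexP (A := `I_f `*` `I_(n ^ f - 1))
    (c := fun g => (`|(height g %% f)%Z|%N, r g)) HG).
- by apply: finite_setX; exact: finite_II.
- move=> g; split=> /=; last by case: (rP g).
  by rewrite -ltz_nat gez0_abs ?modz_ge0 ?ltz_pmod // -lt0n.
move=> g h [hE rE].
have fgh : (f %| height h - height g)%Z.
  rewrite -eqz_mod_dvd; apply/eqP.
  have mod_ge0 m : 0 <= (m %% f)%Z by rewrite modz_ge0 // -lt0n.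
  by rewrite -[LHS]gez0_abs // -[RHS]gez0_abs // hE.
split; first by rewrite (heightM n_gt1) (heightV n_gt1) addrC.
have -> : shift (g^-1 * h)%g / N = (shift h - (r h)%:R) / N
    - (shift g - (r g)%:R) / N + shift g * ((1 - n%:R ^ (height h - height g)) / N).
  rewrite rE (shiftM n_gt1) (shiftV n_gt1).
  rewrite expfzDr ?base_neq0 // -invr_expz -/(scale h) -/(scale g).
  by field; rewrite scale_neq0 // N0.
apply: localizedD.
  by apply: localizedB; [case: (rP h) | case: (rP g)].
apply: localizedM; first exact: shift_localized.
exact: localized_one_sub_exprz.
Qed.

Lemma affine_conj_sym q p (g g' : G) : p != 0 ->
  affine_conj q p g g' <-> affine_conj (- q / p) p^-1 g' g.
Proof.
move=> p0; have scaleE (x y : G) : height x = height y -> scale x = scale y.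
  by rewrite /scale => ->.
by split=> -[sE hE]; split=> //; rewrite sE (scaleE _ _ hE); field.
Qed.

Lemma affine_conj_inj q p (g h k : G) : p != 0 ->
  affine_conj q p g k -> affine_conj q p h k -> g = h.
Proof.
move=> p0 /(affine_conj_sym _ _ _ p0)[sg hg] /(affine_conj_sym _ _ _ p0)[sh hh].
by apply: (affine_inj n_gt1); rewrite ?sg ?sh ?hg ?hh.
Qed.

Lemma affine_conj_fun q p (g h k : G) :
  affine_conj q p k g -> affine_conj q p k h -> g = h.
Proof.
by move=> [sg hg] [sh hh]; apply: (affine_inj n_gt1); rewrite ?sg ?sh ?hg ?hh.
Qed.

Lemma affine_conj1 q p : affine_conj q p (1%g : G) 1%g.
Proof.
split=> //; rewrite /scale (height1 n_gt1) (shift1 n_gt1) expr0z; ring.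
Qed.

Lemma affine_conjM q p (g g' h h' : G) : affine_conj q p g g' ->
  affine_conj q p h h' -> affine_conj q p (g * h)%g (g' * h')%g.
Proof.
move=> [sg hg] [sh hh]; split; last by rewrite !(heightM n_gt1) hg hh.
rewrite !(shiftM n_gt1) (scaleM n_gt1) sg sh.
have -> : scale h' = scale h by rewrite /scale hh.
ring.
Qed.

Lemma affine_conjV q p (g g' : G) : affine_conj q p g g' ->
  affine_conj q p g^-1%g g'^-1%g.
Proof.
move=> [sg hg]; split; last by rewrite !(heightV n_gt1) hg.
rewrite !(shiftV n_gt1) (scaleV n_gt1) sg.
have -> : scale g' = scale g by rewrite /scale hg.
by field; exact: scale_neq0.
Qed.

(** The largest subgroup that the conjugation sends into the model; for p
nonzero its image is the corresponding subgroup for the inverse matrix. *)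
Definition affine_conj_dom q p : set G :=
  [set g | exists g', affine_conj q p g g'].

Lemma affine_conj_dom_fi q p : fi_subgroup (affine_conj_dom q p).
Proof.
have [f f_gt0 [qf pf]] := clear_denominators n_gt1 q p.
apply: (fi_subgroup_sub (congruence_subgroup_fi f_gt0)).
  move=> g [fg Ng].
  have N0 := exprB1_neq0 n_gt1 f_gt0.
  apply: (exists_affine n_gt1).
  have -> : p * shift g + q * (1 - scale g) =
      p * (n%:R ^+ f - 1) * (shift g / (n%:R ^+ f - 1)) +
      q * (n%:R ^+ f - 1) * ((1 - scale g) / (n%:R ^+ f - 1)) by field.
  apply: localizedD; apply: localizedM => //.
  exact: localized_one_sub_exprz.
apply/subgroupP; split.
- by exists 1%g; exact: affine_conj1.
- by move=> g h [g' gg'] [h' hh']; exists (g' * h')%g; exact: affine_conjM.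
- by move=> g [g' gg']; exists g'^-1%g; exact: affine_conjV.
Qed.

Lemma exists_fi_iso q p : p != 0 -> exists f : fi_iso G, represents f q p.
Proof.
move=> p0; pose F (g : G) : G := xget 1%g [set g' | affine_conj q p g g'].
have FP g : affine_conj_dom q p g -> affine_conj q p g (F g).
  by move=> dg; exact: (@xgetPex _ 1%g [set g' | affine_conj q p g g']).
have Fbij : set_bij (affine_conj_dom q p) (affine_conj_dom (- q / p) p^-1) F.
  split.
  - by move=> g /FP gF; exists g; exact/(affine_conj_sym _ _ _ p0).
  - move=> g h; rewrite !inE => /FP gF /FP hF gh; rewrite gh in gF.
    exact: affine_conj_inj p0 gF hF.
  - move=> h [g /(affine_conj_sym _ _ _ p0) gh].
    have dg : affine_conj_dom q p g by exists h.
    by exists g => //; exact: affine_conj_fun (FP _ dg) gh.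
have FM : {in affine_conj_dom q p &, {morph F : x y / (x * y)%g}}.
  move=> g h; rewrite !inE => /FP gF /FP hF.
  have ghF := affine_conjM gF hF.
  have dgh : affine_conj_dom q p (g * h)%g by exists (F g * F h)%g.
  exact: affine_conj_fun (FP _ dgh) ghF.
exists (FiIso (affine_conj_dom_fi q p) (affine_conj_dom_fi _ _) Fbij FM).
by split.
Qed.

End Rigidity.

(** * The isomorphism with the affine matrices *)

Lemma affine_mx_inj q p r s : affine_mx q p = affine_mx r s -> q = r /\ p = s.
Proof.
move=> /eq_block_mx[_ qr _ ps].
split; [move: qr | move: ps]; move/matrixP/(_ 0 0); by rewrite !mxE eqxx !mulr1n.
Qed.

Lemma exists_affine_GL q p : p != 0 ->
  exists A : GL 2 rat, val A = affine_mx q p.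
Proof.
move=> p0; have unitA : affine_mx q p \in unitmx.
  have /mulmx1_unit[] // : affine_mx q p *m affine_mx (- q / p) p^-1 = 1%:M.
  by rewrite affine_mxM affine_mx1 mulfV // -mulrDl addNr mul0r.
by exists (Sub (affine_mx q p) unitA : GL 2 rat); rewrite SubK.
Qed.

Close Scope ring_scope.
Close Scope classical_set_scope.

Theorem mainTheorem1 (n : nat) (hn : (2 <= n)%N) :
  exists f : {multiplicative Comm (BS1 n) -> GL 2 rat},
    set_bij setT affineQ f.
Proof.
have /choice[F FP] (c : Comm (BS1 n)) : exists A : GL 2 rat, exists q p : rat,
    represents (comm_repr c) q p /\ val A = affine_mx q p.
  have [q [p fqp]] := fi_iso_represented hn (comm_repr c).
  have [A AE] := exists_affine_GL q fqp.1.
  by exists A, q, p.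
have F_class (f : fi_iso (BS1 n)) q p : represents f q p ->
    val (F (comm_class f)) = affine_mx q p.
  move=> fqp; have [r [s [rs ->]]] := FP (comm_class f).
  have /comm_classP sim := comm_reprK (comm_class f).
  by have [-> ->] := represents_unique hn sim rs fqp.
have FM : {morph F : c d / (c * d)%g}.
  move=> c d; have [q [p [cqp cE]]] := FP c; have [r [s [drs dE]]] := FP d.
  apply: val_inj; rewrite (F_class _ _ _ (represents_comp cqp drs)).
  by rewrite -affine_mxM -cE -dE.
pose mulF := isMultiplicative.Build (Comm (BS1 n)) (GL 2 rat) F FM.
pose Fm : {multiplicative Comm (BS1 n) -> GL 2 rat} := HB.pack F mulF.
exists Fm; split.
- move=> c _; have [q [p [[p0 _] cE]]] := FP c; by exists q, p.
- move=> c d _ _ /= cd; have [q [p [cqp cE]]] := FP c.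
  have [r [s [drs dE]]] := FP d.
  have [qr ps] : q = r /\ p = s.
    by apply: affine_mx_inj; rewrite -cE -dE; congr val.
  rewrite -(comm_reprK c) -(comm_reprK d); apply/comm_classP.
  by apply: (represents_sim hn cqp); rewrite qr ps.
- move=> A [q [p [p0 AE]]]; have [f fqp] := exists_fi_iso hn q p0.
  by exists (comm_class f) => //; apply: val_inj; rewrite AE; exact: F_class.
Qed.
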